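(* Let $A_n\in\mathrm{GL}(\mathbb R^d)$, $n\in\mathbb N_0$, and consider the system $u_{n+1}=A_nu_n$ with its angular values. For all $s=1,\dots,d$ the following holds. For every $V\in\mathcal G(s,d)$ the limits $\lim_{n\to\infty}\frac1n\sup_{k\in\mathbb N_0}a_{k+1,k+n}(V)$ and $\lim_{n\to\infty}\frac1n\inf_{k\in\mathbb N_0}a_{k+1,k+n}(V)$ occurring in the definition of the uniform outer angular values exist in $[0,\frac\pi2]$, and the $\limsup$ in the definition of $\bar\theta_{[s]}$ is a limit. Moreover, $$\check\theta_{[s]}\le\check\theta_s\le\hat\theta_s\le\hat\theta_{[s]},\qquad \underline\theta_{[s]}\le\underline\theta_s\le\bar\theta_s\le\bar\theta_{[s]},$$ $$\check\theta_{[s]}\le\underline\theta_{[s]},\quad\check\theta_s\le\underline\theta_s,\quad\hat\theta_s\le\bar\theta_s,\quad\hat\theta_{[s]}\le\bar\theta_{[s]}.$$ For the smallest and the largest of these values we have the estimate $$\sup_{V\in\mathcal G(s,d)}\inf_{k\in\mathbb N_0}\measuredangle(\Phi(k,0)V,A_k\Phi(k,0)V)\le\check\theta_{[s]}\le\bar\theta_{[s]}\le\sup_{V\in\mathcal G(s,d)}\sup_{k\in\mathbb N_0}\measuredangle(V,A_kV).$$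
   Context: $\mathcal G(s,d)$ is the set of $s$-dimensional subspaces of $\mathbb R^d$. For $V,W\in\mathcal G(s,d)$ the principal angles $0\le\phi_1\le\dots\le\phi_s\le\frac\pi2$ and principal vectors $v_j\in V$, $w_j\in W$ are defined recursively by $\cos\phi_j=\max\{v^\top w:v\in V,\ w\in W,\ \|v\|=\|w\|=1,\ v^\top v_\ell=0=w^\top w_\ell\text{ for }\ell<j\}=v_j^\top w_j$; $\measuredangle(V,W)=\phi_s$. The solution operator is $\Phi(n,m)=A_{n-1}\cdots A_m$ for $n>m$, $\Phi(n,n)=I$. For $n\in\mathbb N$, $k\in\mathbb N_0$, $V\in\mathcal G(s,d)$ let $a_{k+1,k+n}(V)=\sum_{j=k+1}^{k+n}\measuredangle(\Phi(j-1,0)V,\Phi(j,0)V)$. With suprema over $V\in\mathcal G(s,d)$, the $s$-th angular values are: inner: $\bar\theta_s=\limsup_{n\to\infty}\frac1n\sup_Va_{1,n}(V)$, $\underline\theta_s=\liminf_{n\to\infty}\frac1n\sup_Va_{1,n}(V)$; outer: $\hat\theta_s=\sup_V\limsup_{n\to\infty}\frac1na_{1,n}(V)$, $\check\theta_s=\sup_V\liminf_{n\to\infty}\frac1na_{1,n}(V)$; uniform inner: $\bar\theta_{[s]}=\limsup_{n\to\infty}\frac1n\sup_V\sup_{k\in\mathbb N_0}a_{k+1,k+n}(V)$, $\underline\theta_{[s]}=\liminf_{n\to\infty}\frac1n\sup_V\inf_{k\in\mathbb N_0}a_{k+1,k+n}(V)$; uniform outer: $\hat\theta_{[s]}=\sup_V\lim_{n\to\infty}\frac1n\sup_{k\in\mathbb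 N_0}a_{k+1,k+n}(V)$, $\check\theta_{[s]}=\sup_V\lim_{n\to\infty}\frac1n\inf_{k\in\mathbb N_0}a_{k+1,k+n}(V)$. *)

(* Defs.v *)
From HB Require Import structures.
From mathcomp Require Import all_boot all_order all_algebra.
From mathcomp Require Import all_classical all_reals all_analysis.
Import Order.TTheory GRing.Theory Num.Theory.
Import numFieldNormedType.Exports.

Set Implicit Arguments.
Unset Strict Implicit.
Unset Printing Implicit Defensive.

Local Open Scope classical_set_scope.
Local Open Scope ring_scope.

Definition Gr (R : realType) (s d : nat) : set {vspace 'cV[R]_d} :=
  [set V | \dim V = s].
Arguments Gr R s d : clear implicits.

Definition dotp (R : realType) (d : nat) (x y : 'cV[R]_d) : R :=
  (x^T *m y) ord0 ord0.

(* `|x| on 'cV[R]_d is the sup norm, hence a separate Euclidean norm. *)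
Definition enorm (R : realType) (d : nat) (x : 'cV[R]_d) : R :=
  Num.sqrt (dotp x x).

Definition admissible (R : realType) (d : nat) (V W : {vspace 'cV[R]_d})
    (v w : nat -> 'cV[R]_d) (j : nat) (x y : 'cV[R]_d) : Prop :=
  [/\ x \in V, y \in W, enorm x = 1, enorm y = 1 &
      forall l, (0 < l < j)%N -> dotp x (v l) = 0 /\ dotp y (w l) = 0].

(* Principal vectors and angles are indexed by 1, ..., s; the values of
   v, w, phi at other indices are irrelevant. *)
Definition principal (R : realType) (s d : nat) (V W : {vspace 'cV[R]_d})
    (v w : nat -> 'cV[R]_d) (phi : nat -> R) : Prop :=
  (forall j, (0 < j <= s)%N ->
    [/\ admissible V W v w j (v j) (w j),
        forall x y, admissible V W v w j x y -> dotp x y <= dotp (v j) (w j),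
        cos (phi j) = dotp (v j) (w j) &
        0 <= phi j <= pi / 2]) /\
  (forall i j, (0 < i <= j)%N -> (j <= s)%N -> phi i <= phi j).

(* For V, W in Gr R s d with 0 < s, principal vectors exist by compactness and
   phi s does not depend on their choice, so the set below is a singleton and
   the default value 0 is not used. *)
Definition angle (R : realType) (s d : nat) (V W : {vspace 'cV[R]_d}) : R :=
  xget 0 [set t | exists v w phi, principal s V W v w phi /\ t = phi s].

Definition img (R : realType) (d : nat) (M : 'M[R]_d) (V : {vspace 'cV[R]_d}) :
    {vspace 'cV[R]_d} :=
  (linfun (mulmx M : 'cV[R]_d -> 'cV[R]_d) @: V)%VS.

(* A_(n-1) *m ... *m A_m for m <= n, later factors on the left. *)
Definition Phi (R : realType) (d : nat) (A : nat -> 'M[R]_d) (n m : nat) :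
    'M[R]_d :=
  \big[mulmx/1%:M]_(i <- rev (index_iota m n)) A i.

(* asum s A k n V is a_{k+1,k+n}(V). *)
Definition asum (R : realType) (s d : nat) (A : nat -> 'M[R]_d) (k n : nat)
    (V : {vspace 'cV[R]_d}) : R :=
  \sum_(k.+1 <= j < (k + n).+1)
    angle s (img (Phi A j.-1 0) V) (img (Phi A j 0) V).

(* Suprema, infima and upper/lower limits are taken in the extended reals, where
   they always exist. The term n = 0 of the sequences of averages is a dummy. *)
Local Open Scope ereal_scope.

Section angular_values.
Variables (R : realType) (s d : nat) (A : nat -> 'M[R]_d).

Definition avg (n : nat) (x : \bar R) : \bar R := (n%:R^-1)%:E * x.

Definition sup_avg (V : {vspace 'cV[R]_d}) (n : nat) : \bar R :=
  avg n (ereal_sup [set (asum s A k n V)%:E | k in [set: nat]]).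

Definition inf_avg (V : {vspace 'cV[R]_d}) (n : nat) : \bar R :=
  avg n (ereal_inf [set (asum s A k n V)%:E | k in [set: nat]]).

Definition sup_sup_avg (n : nat) : \bar R :=
  avg n (ereal_sup [set ereal_sup [set (asum s A k n V)%:E | k in [set: nat]]
                   | V in Gr R s d]).

Definition sup_inf_avg (n : nat) : \bar R :=
  avg n (ereal_sup [set ereal_inf [set (asum s A k n V)%:E | k in [set: nat]]
                   | V in Gr R s d]).

(* inner_limsup, inner_liminf           : \bar\theta_s,     \underline\theta_s
   outer_limsup, outer_liminf           : \hat\theta_s,     \check\theta_s
   unif_inner_limsup, unif_inner_liminf : \bar\theta_{[s]}, \underline\theta_{[s]}
   unif_outer_sup, unif_outer_inf       : \hat\theta_{[s]}, \check\theta_{[s]} *)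
Definition inner_limsup : \bar R :=
  limn_esup (fun n => avg n (ereal_sup [set (asum s A 0 n V)%:E | V in Gr R s d])).

Definition inner_liminf : \bar R :=
  limn_einf (fun n => avg n (ereal_sup [set (asum s A 0 n V)%:E | V in Gr R s d])).

Definition outer_limsup : \bar R :=
  ereal_sup [set limn_esup (fun n => avg n (asum s A 0 n V)%:E) | V in Gr R s d].

Definition outer_liminf : \bar R :=
  ereal_sup [set limn_einf (fun n => avg n (asum s A 0 n V)%:E) | V in Gr R s d].

Definition unif_inner_limsup : \bar R := limn_esup sup_sup_avg.

Definition unif_inner_liminf : \bar R := limn_einf sup_inf_avg.

Definition unif_outer_sup : \bar R :=
  ereal_sup [set limn (sup_avg V) | V in Gr R s d].

Definition unif_outer_inf : \bar R :=
  ereal_sup [set limn (inf_avg V) | V in Gr R s d].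

End angular_values.

(* Main.v *)
Require Import Defs.
From HB Require Import structures.
From mathcomp Require Import all_boot all_order all_algebra.
From mathcomp Require Import all_classical all_reals all_analysis.
Import Order.TTheory GRing.Theory Num.Theory.
Import numFieldNormedType.Exports.

(** An angle lies in [[0, pi / 2]], and angle sums are additive over adjacent
    time windows: [a_{k+1,k+m+n}(V) = a_{k+1,k+m}(V) + a_{k+m+1,k+m+n}(V)]
    ([angle_bounds], [asumD]). Nothing else about principal angles is used.

    Additivity makes the suprema [sup_k a_{k+1,k+n}(V)] and
    [sup_V sup_k a_{k+1,k+n}(V)] subadditive in [n], and [inf_k a_{k+1,k+n}(V)]
    superadditive, with values between [0] and [n * pi / 2]. Fekete's lemma
    ([fekete], [fekete_super]) then gives the limits ([sup_avg_cvg],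
    [inf_avg_cvg], [sup_sup_avg_cvg]).

    The limits being upper and lower limits as well, each inequality between two
    angular values follows from the monotonicity of suprema, averages, upper
    limits and lower limits, applied to an inequality valid for each fixed [n]:
    the value at [k = 0] lies between the infimum and the supremum over [k], the
    value at one [V] lies below the supremum over [V], and a lower limit lies
    below the upper limit.

    For the outermost estimates, a window of length [n] is a sum of [n] angles,
    so its average is at least the infimum of the angles along the orbit of [V]
    ([sup_inf_angle_le]). It is at most the supremum of the angles between [W]
    and [A_k W] over all [W] of dimension [s] and all [k], because invertible
    matrices keep the orbit in the Grassmannian
    ([unif_inner_limsup_le_sup_angle]). *)

Set Implicit Arguments.
Unset Strict Implicit.
Unset Printing Implicit Defensive.

Local Open Scope classical_set_scope.
Local Open Scope ring_scope.

(** * Averages of subadditive and superadditive sequences *)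

(** Fekete's lemma, for a nonnegative sequence of at most linear growth. The
    limit is the infimum of the averages. *)
Lemma fekete (R : realType) (C : R) (u : nat -> R) :
    (forall n, 0 <= u n <= C * n%:R) ->
    (forall m n, u (m + n)%N <= u m + u n) ->
  exists2 l : R, 0 <= l <= C & (n%:R^-1 * u n) @[n --> \oo] --> l.
Proof.
move=> bu subu.
have u0 n : 0 <= u n by case/andP: (bu n).
have uC n : u n <= C * n%:R by case/andP: (bu n).
have C0 : 0 <= C by have := le_trans (u0 1%N) (uC 1%N); rewrite mulr1.
pose a n := n.+1%:R^-1 * u n.+1.
have a0 n : 0 <= a n by rewrite mulr_ge0// invr_ge0.
have aC n : a n <= C by rewrite /a mulrC ler_pdivrMr.
have lba : lbound (range a) 0 by move=> _ [n _ <-].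
have ia : has_inf (range a) by split; [exists (a 0%N), 0%N|exists 0].
exists (inf (range a)).
  apply/andP; split; first by apply: lb_le_inf => //; exists (a 0%N), 0%N.
  by apply: le_trans (aC 0%N); apply: ge_inf; [exists 0|exists 0%N].
have umul q m r : u (q * m + r)%N <= q%:R * u m + u r.
  elim: q => [|q IH]; first by rewrite mul0n add0n mul0r add0r.
  rewrite mulSn -addnA (le_trans (subu _ _))// -natr1 mulrDl mul1r.
  by rewrite [_ * _ + u m]addrC -addrA lerD2l.
apply/cvgrPdist_le => e e0; have e20 : 0 < e / 2 by rewrite divr_gt0.
have [_ [m _ <-] am] := inf_adherent e20 ia.
near=> n.
have n0 : (0 < n)%N by near: n; exact: nbhs_infty_gt.
have n0R : 0 < n%:R :> R by rewrite ltr0n.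
rewrite distrC ger0_norm; last first.
  rewrite subr_ge0 ge_inf//; first by exists 0.
  by exists n.-1 => //; rewrite /a prednK.
rewrite lerBlDl (le_trans (_ : _ <= a m + e / 2))//; last first.
  by rewrite [e in leRHS]splitr addrA lerD2r ltW.
(* Split a window of length [n] into [n %/ m.+1] windows of length [m.+1] and
   a remainder shorter than [m.+1]. *)
have un : u n <= n%:R * a m + C * m.+1%:R.
  rewrite {1}(divn_eq n m.+1) (le_trans (umul _ _ _))// lerD//.
    rewrite mulrA ler_wpM2r// ler_pdivlMr ?ltr0n// -natrM ler_nat.
    exact: leq_divM.
  by rewrite (le_trans (uC _))// ler_wpM2l// ler_nat ltnW// ltn_mod.
rewrite mulrC ler_pdivrMr// (le_trans un)// mulrDl mulrC lerD2l.
rewrite -ler_pdivrMl//; near: n; exact: nbhs_infty_ger.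
Unshelve. all: by end_near. Qed.

(** The superadditive case reduces to the subadditive one by
    replacing [u n] with [C * n - u n]. *)
Lemma fekete_super (R : realType) (C : R) (u : nat -> R) :
    (forall n, 0 <= u n <= C * n%:R) ->
    (forall m n, u m + u n <= u (m + n)%N) ->
  exists2 l : R, 0 <= l <= C & (n%:R^-1 * u n) @[n --> \oo] --> l.
Proof.
move=> bu superu; have [n|m n|l /andP[l0 lC] vl] :=
    @fekete R C (fun n => C * n%:R - u n).
- by have /andP[? ?] := bu n; rewrite subr_ge0 gerBl; apply/andP.
- by rewrite addrACA -opprD natrD mulrDr lerD2l lerN2.
exists (C - l); first by rewrite subr_ge0 lC gerBl.
have : C - n%:R^-1 * (C * n%:R - u n) @[n --> \oo] --> C - l.
  by apply: cvgB => //; exact: cvg_cst.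
apply: cvg_trans; apply: near_eq_cvg; near=> n.
have n0 : n%:R != 0 :> R.
  by rewrite pnatr_eq0 -lt0n; near: n; exact: nbhs_infty_gt.
by rewrite mulrBr mulrCA mulVf// mulr1 opprB addrC subrK.
Unshelve. all: by end_near. Qed.

Local Open Scope ereal_scope.

Lemma avg_cvg_EFin (R : realType) (U : nat -> \bar R) (l : R) :
    (forall n, U n \is a fin_num) ->
    (n%:R^-1 * fine (U n))%R @[n --> \oo] --> l ->
  (fun n => avg n (U n)) @ \oo --> l%:E.
Proof.
move=> fU ul; have -> : (fun n => avg n (U n)) =
    (fun n => (n%:R^-1 * fine (U n))%:E).
  by apply/funext => n; rewrite /avg -{1}(fineK (fU n)).
by apply: cvg_EFin => //; exact: nearW.
Qed.

Section ereal_fekete.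
Variables (R : realType) (C : R) (U : nat -> \bar R).
Hypothesis bU : forall n, 0 <= U n <= (C * n%:R)%:E.

Let fU n : U n \is a fin_num.
Proof.
have /andP[U0 UC] := bU n.
by rewrite ge0_fin_numE// (le_lt_trans UC)// ltry.
Qed.

Let bfU n : (0 <= fine (U n) <= C * n%:R)%R.
Proof. by rewrite -!lee_fin fineK. Qed.

Lemma avg_subadditive_cvg : (forall m n, U (m + n)%N <= U m + U n) ->
  exists2 l : R, (0 <= l <= C)%R & (fun n => avg n (U n)) @ \oo --> l%:E.
Proof.
move=> subU; have [|l lC ul] := fekete bfU.
  by move=> m n; rewrite -lee_fin EFinD !fineK.
by exists l => //; exact: avg_cvg_EFin.
Qed.

Lemma avg_superadditive_cvg : (forall m n, U m + U n <= U (m + n)%N) ->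
  exists2 l : R, (0 <= l <= C)%R & (fun n => avg n (U n)) @ \oo --> l%:E.
Proof.
move=> superU; have [|l lC ul] := fekete_super bfU.
  by move=> m n; rewrite -lee_fin EFinD !fineK.
by exists l => //; exact: avg_cvg_EFin.
Qed.

End ereal_fekete.

(** * Monotonicity of suprema, averages and upper and lower limits *)

Lemma le_ereal_sup_image (R : realType) T (D : set T) (f g : T -> \bar R) :
  (forall x, D x -> f x <= g x) ->
  ereal_sup [set f x | x in D] <= ereal_sup [set g x | x in D].
Proof.
move=> fg; apply: ge_ereal_sup => _ [x Dx <-].
by apply: le_ereal_sup_tmp; exists (g x); [exists x|exact: fg].
Qed.

Lemma le_limn_esup (R : realType) (u v : nat -> \bar R) :
  (forall n, u n <= v n) -> limn_esup u <= limn_esup v.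
Proof.
move=> uv; rewrite !limn_esup_lim; apply: lee_lim => //.
  exact: is_cvg_esups.
  exact: is_cvg_esups.
by apply: nearW => n; exact: le_ereal_sup_image.
Qed.

Lemma le_limn_einf (R : realType) (u v : nat -> \bar R) :
  (forall n, u n <= v n) -> limn_einf u <= limn_einf v.
Proof.
by move=> uv; rewrite leeN2; apply: le_limn_esup => n; rewrite leeN2.
Qed.

Lemma le_avg (R : realType) (n : nat) (x y : \bar R) :
  x <= y -> avg n x <= avg n y.
Proof. by move=> xy; rewrite lee_wpmul2l// lee_fin invr_ge0. Qed.

(** The term [n = 0] of a sequence of averages is zero, hence the condition. *)
Lemma avg_mulrn (R : realType) (n : nat) (x : \bar R) : (0 < n)%N ->
  avg n (n%:R%:E * x) = x.
Proof.
by move=> n0; rewrite /avg muleA -EFinM mulVf ?mul1e// pnatr_eq0 -lt0n.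
Qed.

Lemma sume_const_nat (R : realType) (m n : nat) (x : \bar R) :
  \sum_(m <= i < m + n) x = n%:R%:E * x.
Proof.
rewrite big_const_nat addKn mule_natl.
by elim: n => [|n IH]; rewrite ?muleS -?IH.
Qed.

(** * Angles and their sums along the orbit of a subspace *)

(** The bounds hold for all subspaces: if there are no principal vectors the
    angle is the default value [0]. *)
Lemma angle_bounds (R : realType) (s d : nat) (V W : {vspace 'cV[R]_d}) :
  (0 < s)%N -> (0 <= angle s V W <= pi / 2)%R.
Proof.
move=> s0; rewrite /angle; case: xgetP => [t _|_].
  case=> v [w [phi [[/(_ s) H _] ->]]].
  by have [|_ _ _] := H; rewrite ?s0/=.
by rewrite lexx divr_ge0// pi_ge0.
Qed.

Lemma img_mulmx (R : realType) (d : nat) (M N : 'M[R]_d)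
    (V : {vspace 'cV[R]_d}) : img (M *m N) V = img M (img N V).
Proof.
rewrite /img -limg_comp; apply: eq_in_limg => x _.
by rewrite comp_lfunE !lfunE/= mulmxA.
Qed.

Lemma Gr_img (R : realType) (s d : nat) (M : 'M[R]_d) (V : {vspace 'cV[R]_d}) :
  M \in unitmx -> Gr R s d V -> Gr R s d (img M V).
Proof.
move=> Mu; rewrite /Gr/= => <-; apply: limg_dim_eq.
suff /eqP -> : lker (linfun (mulmx M : 'cV[R]_d -> 'cV[R]_d)) == 0%VS.
  by rewrite capv0.
apply/lker0P => x y; rewrite !lfunE/= => Mxy.
by rewrite -[x](mulKmx Mu) Mxy mulKmx.
Qed.

Lemma Gr_nonempty (R : realType) (s d : nat) : (s <= d)%N -> Gr R s d !=set0.
Proof.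
move=> sd; pose X := vbasis (fullv : {vspace 'cV[R]_d}).
have fX : free (take s X).
  apply: (@catl_free _ _ (drop s X)).
  by rewrite cat_take_drop (basis_free (vbasisP _)).
exists <<take s X>>%VS; rewrite /Gr/= (eqP fX) size_takel//.
by rewrite size_tuple dimvf /dim/= muln1.
Qed.

Lemma PhiS (R : realType) (d : nat) (A : nat -> 'M[R]_d) (k : nat) :
  Phi A k.+1 0 = A k *m Phi A k 0.
Proof.
by rewrite /Phi /index_iota !subn0 -addn1 iotaD cats1 rev_rcons big_cons.
Qed.

Lemma Phi_unitmx (R : realType) (d : nat) (A : nat -> 'M[R]_d) (k : nat) :
  (forall n, A n \in unitmx) -> Phi A k 0 \in unitmx.
Proof.
move=> hA; elim: k => [|k IH].
  by rewrite /Phi /index_iota big_nil unitmx1.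
by rewrite PhiS unitmx_mul hA.
Qed.

(** * Convergence and comparison of the angular values *)

Section angle_sums.
Variables (R : realType) (s d : nat) (A : nat -> 'M[R]_d).
Implicit Types V : {vspace 'cV[R]_d}.

(** The sum [a_{k+1,k+n}(V)], reindexed by the time at the start of each step
    instead of the time at its end. *)
Lemma asumE k n V : asum s A k n V =
  (\sum_(k <= j < k + n)
     angle s (img (Phi A j 0) V) (img (A j *m Phi A j 0) V))%R.
Proof. by rewrite /asum big_add1; apply: eq_bigr => j _; rewrite PhiS. Qed.

Lemma asumD k m n V : asum s A k (m + n) V =
  (asum s A k m V + asum s A (k + m) n V)%R.
Proof.
by rewrite !asumE (@big_cat_nat _ _ _ (k + m)) ?addnA ?leq_addr.
Qed.

Lemma asum_le (c : \bar R) k n V :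
    (forall j, (angle s (img (Phi A j 0) V)
                        (img (A j *m Phi A j 0) V))%:E <= c) ->
  (asum s A k n V)%:E <= n%:R%:E * c.
Proof.
by move=> hc; rewrite asumE -sumEFin -(sume_const_nat k) lee_sum.
Qed.

Lemma asum_ge (c : \bar R) k n V :
    (forall j, c <= (angle s (img (Phi A j 0) V)
                             (img (A j *m Phi A j 0) V))%:E) ->
  n%:R%:E * c <= (asum s A k n V)%:E.
Proof.
by move=> hc; rewrite asumE -sumEFin -(sume_const_nat k) lee_sum.
Qed.

Lemma asum_bounds k n V : (0 < s)%N ->
  0 <= (asum s A k n V)%:E <= (pi / 2 * n%:R)%:E.
Proof.
move=> s0; apply/andP; split.
  rewrite -(mule0 n%:R%:E); apply: asum_ge => j.
  by have /andP[] := angle_bounds (img (Phi A j 0) V)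
    (img (A j *m Phi A j 0) V) s0.
rewrite mulrC EFinM; apply: asum_le => j.
by have /andP[] := angle_bounds (img (Phi A j 0) V)
  (img (A j *m Phi A j 0) V) s0.
Qed.

(** The supremum over the starting times is subadditive in the length of the
    time window, and the infimum is superadditive, because a window of length
    [m + n] splits into adjacent windows of lengths [m] and [n]. *)
Lemma sup_asumD m n V :
  ereal_sup [set (asum s A k (m + n) V)%:E | k in [set: nat]] <=
  ereal_sup [set (asum s A k m V)%:E | k in [set: nat]] +
  ereal_sup [set (asum s A k n V)%:E | k in [set: nat]].
Proof.
apply: ge_ereal_sup => _ [k _ <-]; rewrite asumD EFinD.
by apply: leeD; apply: ereal_sup_ubound; [exists k|exists (k + m)%N].
Qed.

Lemma inf_asumD m n V :
  ereal_inf [set (asum s A k m V)%:E | k in [set: nat]] +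
  ereal_inf [set (asum s A k n V)%:E | k in [set: nat]] <=
  ereal_inf [set (asum s A k (m + n) V)%:E | k in [set: nat]].
Proof.
apply: le_ereal_inf_tmp => _ [k _ <-]; rewrite asumD EFinD.
by apply: leeD; apply: ereal_inf_lbound; [exists k|exists (k + m)%N].
Qed.

Lemma sup_asum_bounds n V : (0 < s)%N ->
  0 <= ereal_sup [set (asum s A k n V)%:E | k in [set: nat]]
    <= (pi / 2 * n%:R)%:E.
Proof.
move=> s0; apply/andP; split.
  apply: le_ereal_sup_tmp; exists (asum s A 0 n V)%:E; first by exists 0%N.
  by have /andP[] := asum_bounds 0 n V s0.
by apply: ge_ereal_sup => _ [k _ <-]; have /andP[] := asum_bounds k n V s0.
Qed.

Lemma inf_asum_bounds n V : (0 < s)%N ->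
  0 <= ereal_inf [set (asum s A k n V)%:E | k in [set: nat]]
    <= (pi / 2 * n%:R)%:E.
Proof.
move=> s0; apply/andP; split.
  apply: le_ereal_inf_tmp => _ [k _ <-].
  by have /andP[] := asum_bounds k n V s0.
apply: ge_ereal_inf; exists (asum s A 0 n V)%:E; first by exists 0%N.
by have /andP[] := asum_bounds 0 n V s0.
Qed.

Lemma sup_avg_cvg V : (0 < s)%N ->
  exists2 l : R, (0 <= l <= pi / 2)%R & sup_avg s A V @ \oo --> l%:E.
Proof.
move=> s0; apply: avg_subadditive_cvg => [n|m n].
  exact: sup_asum_bounds.
exact: sup_asumD.
Qed.

Lemma inf_avg_cvg V : (0 < s)%N ->
  exists2 l : R, (0 <= l <= pi / 2)%R & inf_avg s A V @ \oo --> l%:E.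
Proof.
move=> s0; apply: avg_superadditive_cvg => [n|m n].
  exact: inf_asum_bounds.
exact: inf_asumD.
Qed.

Lemma sup_sup_avg_cvg : (0 < s <= d)%N ->
  sup_sup_avg s A @ \oo --> unif_inner_limsup s A.
Proof.
move=> /andP[s0 sd]; have [V0 GV0] := Gr_nonempty R sd.
have [n|m n|l _ hl] := @avg_subadditive_cvg R (pi / 2) (fun n =>
  ereal_sup [set ereal_sup [set (asum s A k n V)%:E | k in [set: nat]]
            | V in Gr R s d]).
- apply/andP; split.
    apply: le_ereal_sup_tmp.
    exists (ereal_sup [set (asum s A k n V0)%:E | k in [set: nat]]).
      by exists V0.
    by have /andP[] := sup_asum_bounds n V0 s0.
  apply: ge_ereal_sup => _ [V _ <-].
  by have /andP[] := sup_asum_bounds n V s0.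
- apply: ge_ereal_sup => _ [V GV <-]; apply: le_trans (sup_asumD m n V) _.
  by apply: leeD; apply: ereal_sup_ubound; exists V.
by rewrite /unif_inner_limsup; have [_ ->] := cvg_limn_einf_sup hl.
Qed.

Lemma limn_sup_avg V : (0 < s)%N ->
  limn (sup_avg s A V) = limn_esup (sup_avg s A V).
Proof.
move=> s0; have [l _ hl] := sup_avg_cvg V s0.
by rewrite is_cvg_limn_esupE//; apply/cvg_ex; exists l%:E.
Qed.

Lemma limn_inf_avg V : (0 < s)%N ->
  limn (inf_avg s A V) = limn_einf (inf_avg s A V).
Proof.
move=> s0; have [l _ hl] := inf_avg_cvg V s0.
by rewrite is_cvg_limn_einfE//; apply/cvg_ex; exists l%:E.
Qed.

Lemma inf_avg_le V n : inf_avg s A V n <= avg n (asum s A 0 n V)%:E.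
Proof. by apply: le_avg; apply: ereal_inf_lbound; exists 0%N. Qed.

Lemma le_sup_avg V n : avg n (asum s A 0 n V)%:E <= sup_avg s A V n.
Proof. by apply: le_avg; apply: ereal_sup_ubound; exists 0%N. Qed.

Lemma unif_outer_inf_le : (0 < s)%N -> unif_outer_inf s A <= outer_liminf s A.
Proof.
move=> s0; apply: le_ereal_sup_image => V _; rewrite limn_inf_avg//.
by apply: le_limn_einf; exact: inf_avg_le.
Qed.

Lemma outer_liminf_le_limsup : outer_liminf s A <= outer_limsup s A.
Proof. by apply: le_ereal_sup_image => V _; exact: limn_einf_sup. Qed.

Lemma outer_limsup_le : (0 < s)%N -> outer_limsup s A <= unif_outer_sup s A.
Proof.
move=> s0; apply: le_ereal_sup_image => V _; rewrite limn_sup_avg//.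
by apply: le_limn_esup; exact: le_sup_avg.
Qed.

Lemma unif_inner_liminf_le : unif_inner_liminf s A <= inner_liminf s A.
Proof.
apply: le_limn_einf => n; apply: le_avg; apply: le_ereal_sup_image => V _.
by apply: ereal_inf_lbound; exists 0%N.
Qed.

Lemma inner_limsup_le : inner_limsup s A <= unif_inner_limsup s A.
Proof.
apply: le_limn_esup => n; apply: le_avg; apply: le_ereal_sup_image => V _.
by apply: ereal_sup_ubound; exists 0%N.
Qed.

Lemma unif_outer_inf_le_inner : (0 < s)%N ->
  unif_outer_inf s A <= unif_inner_liminf s A.
Proof.
move=> s0; apply: ge_ereal_sup => _ [V GV <-]; rewrite limn_inf_avg//.
apply: le_limn_einf => n; apply: le_avg.
by apply: ereal_sup_ubound; exists V.
Qed.

Lemma outer_liminf_le_inner : outer_liminf s A <= inner_liminf s A.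
Proof.
apply: ge_ereal_sup => _ [V GV <-]; apply: le_limn_einf => n; apply: le_avg.
by apply: ereal_sup_ubound; exists V.
Qed.

Lemma outer_limsup_le_inner : outer_limsup s A <= inner_limsup s A.
Proof.
apply: ge_ereal_sup => _ [V GV <-]; apply: le_limn_esup => n; apply: le_avg.
by apply: ereal_sup_ubound; exists V.
Qed.

Lemma unif_outer_sup_le_inner : (0 < s)%N ->
  unif_outer_sup s A <= unif_inner_limsup s A.
Proof.
move=> s0; apply: ge_ereal_sup => _ [V GV <-]; rewrite limn_sup_avg//.
apply: le_limn_esup => n; apply: le_avg.
by apply: ereal_sup_ubound; exists V.
Qed.

Lemma sup_inf_angle_le : (0 < s)%N ->
  ereal_sup [set ereal_inf
      [set (angle s (img (Phi A k 0) V) (img (A k *m Phi A k 0) V))%:E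
      | k in [set: nat]]
    | V in Gr R s d] <= unif_outer_inf s A.
Proof.
move=> s0; apply: le_ereal_sup_image => V _.
have [l _ hl] := inf_avg_cvg V s0; have cvl : cvgn (inf_avg s A V).
  by apply/cvg_ex; exists l%:E.
apply: lime_ge => //; near=> n.
have n0 : (0 < n)%N by near: n; exact: nbhs_infty_gt.
rewrite -[leLHS](avg_mulrn _ n0); apply: le_avg.
apply: le_ereal_inf_tmp => _ [k _ <-]; apply: asum_ge => j.
by apply: ereal_inf_lbound; exists j.
Unshelve. all: by end_near. Qed.

(** Invertible matrices preserve the dimension, so the angle at time [j] along
    the orbit of [V] is one of the angles on the right-hand side. *)
Lemma unif_inner_limsup_le_sup_angle : (0 < s <= d)%N ->
    (forall n, A n \in unitmx) ->
  unif_inner_limsup s A <=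
  ereal_sup [set ereal_sup [set (angle s V (img (A k) V))%:E | k in [set: nat]]
            | V in Gr R s d].
Proof.
move=> hs hA; have cvl := sup_sup_avg_cvg hs.
rewrite -(cvg_lim _ cvl)//; apply: lime_le.
  by apply/cvg_ex; eexists; exact: cvl.
near=> n; have n0 : (0 < n)%N by near: n; exact: nbhs_infty_gt.
rewrite -[leRHS](avg_mulrn _ n0); apply: le_avg.
apply: ge_ereal_sup => _ [V GV <-]; apply: ge_ereal_sup => _ [k _ <-].
apply: asum_le => j; rewrite img_mulmx.
apply: le_ereal_sup_tmp; exists (ereal_sup [set
    (angle s (img (Phi A j 0) V) (img (A i) (img (Phi A j 0) V)))%:E
    | i in [set: nat]]).
  by exists (img (Phi A j 0) V) => //; exact/Gr_img/GV/Phi_unitmx.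
by apply: ereal_sup_ubound; exists j.
Unshelve. all: by end_near. Qed.

End angle_sums.

Theorem lemma3p3 (R : realType) (d : nat) (A : nat -> 'M[R]_d)
    (hA : forall n, A n \in unitmx) (s : nat) (hs : (1 <= s <= d)%N) :
  (forall V, Gr R s d V ->
     (exists2 l : R, (0 <= l <= pi / 2)%R & sup_avg s A V @ \oo --> l%:E) /\
     (exists2 l : R, (0 <= l <= pi / 2)%R & inf_avg s A V @ \oo --> l%:E)) /\
  (sup_sup_avg s A @ \oo --> unif_inner_limsup s A) /\
  [/\ unif_outer_inf s A <= outer_liminf s A,
      outer_liminf s A <= outer_limsup s A &
      outer_limsup s A <= unif_outer_sup s A] /\
  [/\ unif_inner_liminf s A <= inner_liminf s A,
      inner_liminf s A <= inner_limsup s A &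
      inner_limsup s A <= unif_inner_limsup s A] /\
  [/\ unif_outer_inf s A <= unif_inner_liminf s A,
      outer_liminf s A <= inner_liminf s A,
      outer_limsup s A <= inner_limsup s A &
      unif_outer_sup s A <= unif_inner_limsup s A] /\
  [/\ ereal_sup [set ereal_inf
          [set (angle s (img (Phi A k 0) V) (img (A k *m Phi A k 0) V))%:E
          | k in [set: nat]]
        | V in Gr R s d] <= unif_outer_inf s A,
      unif_outer_inf s A <= unif_inner_limsup s A &
      unif_inner_limsup s A <=
        ereal_sup [set ereal_sup
            [set (angle s V (img (A k) V))%:E | k in [set: nat]]
          | V in Gr R s d]].
Proof.
have /andP[s0 sd] := hs.
split; first by move=> V _; split; [exact: sup_avg_cvg|exact: inf_avg_cvg].
do 5?split.
- exact: sup_sup_avg_cvg.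
- exact: unif_outer_inf_le.
- exact: outer_liminf_le_limsup.
- exact: outer_limsup_le.
- exact: unif_inner_liminf_le.
- exact: limn_einf_sup.
- exact: inner_limsup_le.
- exact: unif_outer_inf_le_inner.
- exact: outer_liminf_le_inner.
- exact: outer_limsup_le_inner.
- exact: unif_outer_sup_le_inner.
- exact: sup_inf_angle_le.
- apply: le_trans (unif_outer_inf_le_inner A s0) _.
  apply: le_trans (unif_inner_liminf_le s A) _.
  exact: le_trans (limn_einf_sup _) (inner_limsup_le s A).
- exact: unif_inner_limsup_le_sup_angle.
Qed.
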